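(* Let $n\ge 2$ and let $P$ be a set of $2n$ points in general position in the plane. Let $r$ be an integer with $1\le r\le n-1$. Suppose that every point of $P$ lies on exactly one $0$-halving line of $P$, and, for every $k=1,2,\dots,r$, every point of $P$ lies on exactly two $k$-halving lines of $P$. Then the edges of the complete geometric graph on $P$ can be partitioned into $n$ plane spanning trees that are symmetric caterpillars and are pairwise graph-isomorphic.
   Context: General position: no three points collinear. The complete geometric graph on $P$ has vertex set $P$ and every pair of points joined by a straight-line segment; a plane spanning tree is a spanning tree of it whose edges pairwise do not cross (meet only at common endpoints). For $0\le k\le n-1$, a $k$-halving line of $P$ is a line through two points of $P$ that splits the remaining $2n-2$ points of $P$ into the two open sides of the line with sizes $n-1-k$ and $n-1+k$ ($0$-halving lines are the halving lines). A caterpillar is a tree such that deleting all its vertices of degree $1$ leaves a path. A tree $T$ is symmetric if there is an edge $vw$ of $T$ such that, letting $A$ and $B$ be the components of $T-vw$ with $v\in A$, $w\in B$, there is a graph isomorphism from $A$ to $B$ mapping $v$ to $w$. A partition of the edges means the edge sets of the trees are pairwise disjoint with union all edges. *)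

(* Defs.v *)
From mathcomp Require Import all_boot all_order all_algebra.
From mathcomp Require Import finmap classical_sets cardinality reals.

Set Implicit Arguments.
Unset Strict Implicit.
Unset Printing Implicit Defensive.

Import Order.TTheory GRing.Theory Num.Theory.

Local Open Scope ring_scope.

(* A graph is given by a vertex set [W : {set V}] in an ambient finType and a
   set [E] of unordered pairs; [E ::&: W] is the edge set induced on [W]. *)
Section Graphs.
Variable V : finType.
Implicit Types (E : {set {set V}}) (W : {set V}).

Definition complete_edges : {set {set V}} := [set e : {set V} | #|e| == 2]%SET.

Definition adj E : rel V := fun x y => [set x; y]%SET \in E.

Definition degree E (x : V) : nat := #|[set y | adj E x y]%SET|.

Definition acyclic E : Prop :=
  forall c : seq V, (2 < size c)%N -> ~~ ucycleb (adj E) c.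

Definition spanning_tree E : Prop :=
  [/\ E \subset complete_edges,
      forall x y, connect (adj E) x y
    & acyclic E].

Definition path_graph W E : Prop :=
  exists s : seq V,
    [/\ uniq s,
        W = [set x in s]%SET
      & E = [set [set u.1; u.2] | u in zip s (behead s)]%SET].

(* For a spanning tree [E]. *)
Definition caterpillar E : Prop :=
  let W := [set x | degree E x != 1]%SET in path_graph W (E ::&: W)%SET.

Definition component E (v : V) : {set V} := [set x | connect (adj E) v x]%SET.

End Graphs.

Definition graph_isomorphism (V1 V2 : finType)
    (W1 : {set V1}) (E1 : {set {set V1}}) (W2 : {set V2}) (E2 : {set {set V2}})
    (f : V1 -> V2) : Prop :=
  [/\ {in W1 &, injective f},
      (f @: W1)%SET = W2
    & {in W1 &, forall x y, adj E1 x y = adj E2 (f x) (f y)}].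

Definition isomorphic (V : finType) (E1 E2 : {set {set V}}) : Prop :=
  exists f : V -> V, graph_isomorphism [set: V]%SET E1 [set: V]%SET E2 f.

(* For a spanning tree [E]. *)
Definition symmetric_tree (V : finType) (E : {set {set V}}) : Prop :=
  exists v w : V,
    [set v; w]%SET \in E /\
    let E' := (E :\ [set v; w])%SET in
    exists2 f : V -> V,
      graph_isomorphism (component E' v) (E' ::&: component E' v)%SET
                        (component E' w) (E' ::&: component E' w)%SET f
      & f v = w.

Section Plane.
Variable R : realType.
Local Notation point := 'rV[R]_2.
Implicit Types (p q z : point) (P : {fset point}).

(* The determinant of (q - p, z - p): positive when z lies strictly to the left
   of the line directed from p to q, negative strictly to the right. *)
Definition orient p q z : R :=
  (q 0 0 - p 0 0) * (z 0 1 - p 0 1) - (q 0 1 - p 0 1) * (z 0 0 - p 0 0).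

Definition line p q : set point := [set z | orient p q z = 0]%classic.

Definition segment p q : set point :=
  [set z | exists t : R, 0 <= t <= 1 /\ z = (1 - t) *: p + t *: q]%classic.

Definition general_position P : Prop :=
  forall p q z, p \in P -> q \in P -> z \in P ->
    p != q -> p != z -> q != z -> ~ line p q z.

(* [p] and [q] are ordered, so fixing which side gets [n - 1 - k] points is no
   restriction: exchanging [p] and [q] exchanges the sides. *)
Definition halving_line (n : nat) P (k : nat) (L : set point) : Prop :=
  exists p q,
    [/\ p \in P, q \in P, p != q & L = line p q] /\
    #|` [fset z in P | 0 < orient p q z]%fset| = (n - 1 - k)%N /\
    #|` [fset z in P | orient p q z < 0]%fset| = (n - 1 + k)%N.

Definition halving_lines_at (n : nat) P (k : nat) p : set (set point) :=
  [set L | halving_line n P k L /\ L p]%classic.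

Definition plane P (E : {set {set P}}) : Prop :=
  forall a b c d : P,
    [set a; b]%SET \in E -> [set c; d]%SET \in E ->
    [set a; b]%SET != [set c; d]%SET ->
    forall z, segment (val a) (val b) z -> segment (val c) (val d) z ->
      exists2 x : P, x \in ([set a; b] :&: [set c; d])%SET & z = val x.

End Plane.

(* Main.v *)
Require Import Defs.
From mathcomp Require Import all_boot all_order all_algebra.
From mathcomp Require Import finmap classical_sets cardinality reals.
From mathcomp Require Import ring lra zify.

Set Implicit Arguments.
Unset Strict Implicit.
Unset Printing Implicit Defensive.

Import Order.TTheory GRing.Theory Num.Theory.

Local Open Scope ring_scope.

(** Match every point [x] with the other point [x'] of its unique 0-halving line.
    Any two matched segments cross: if [y] and [y'] were on the same side of the line [xx'],
    with [y] the closer of the two to it, then turning a line about [y] from the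
    direction of [xx'] to that of [yy'] would change the number of points on one
    side from too few to too many while [y'] stays on that side, hence would
    meet a second halving line through [y].
    The trees are double stars: the one of [{x, x'}] joins [x] to the points on
    the left of the line directed from [x] to [x'], and [x'] to those on the
    right. It is plane because its two stars lie on different sides of [xx'],
    and since [xx'] and [yy'] cross, the edge [xy] is in the tree of exactly one
    of them. *)

(** * Bijections between finite sets of equal size *)

Section Equicardinal.
Local Open Scope set_scope.

(** The map is total on [V], as [graph_isomorphism] requires; it matches the enumerations of [A] and
    [B] position by position. *)
Lemma equicardinal_bijection (V : finType) (A B : {set V}) : #|A| = #|B| ->
  exists f : V -> V, {in A &, injective f} /\ f @: A = B.
Proof.
move=> eqAB; case: (set_0Vmem A) => [A0|[a aA]].
  exists id; split=> //; apply/eqP; rewrite imset_id A0 eq_sym -cards_eq0 -eqAB.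
  by rewrite A0 cards0.
exists (fun x => nth a (enum B) (index x (enum A))).
have szAB : size (enum A) = size (enum B) by rewrite -!cardE.
have injf : {in A &, injective (fun x => nth a (enum B) (index x (enum A)))}.
  move=> x y xA yA /eqP.
  rewrite nth_uniq ?enum_uniq -?szAB ?index_mem ?mem_enum //.
  by move/eqP/index_inj; apply; rewrite ?mem_enum.
split=> //; apply/eqP; rewrite eqEcard (card_in_imset injf) eqAB leqnn andbT.
apply/fintype.subsetP => _ /imsetP[x xA ->].
by rewrite -mem_enum mem_nth // -szAB index_mem mem_enum.
Qed.

End Equicardinal.

(** * Combinatorics of double stars over a perfect matching *)

Section DoubleStars.
Local Open Scope set_scope.
(** Here [m] is the matching, and [left x y] abstracts that [y] lies to the left of the line
    directed from [x] to [m x]. Reversing this line gives [left_opp]; the crossing of matched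
    segments enters only through [left_swap]. *)
Variables (V : finType) (m : V -> V) (left : rel V) (k : nat).
Hypothesis mK : involutive m.
Hypothesis m_neq : forall x, m x != x.
Hypothesis leftxx : forall x, left x x = false.
Hypothesis leftxm : forall x, left x (m x) = false.
Hypothesis left_opp :
  forall x y, y != x -> y != m x -> left (m x) y = ~~ left x y.
Hypothesis left_swap :
  forall x y, y != x -> y != m x -> left y x = ~~ left x y.
Hypothesis card_left : forall x, #|[set y | left x y]| = k.
Hypothesis k_gt0 : (0 < k)%N.

(** An orientation of the complete graph: matching edges run both ways, and by [left_swap] every
    other edge runs exactly one way. The tree of [x] consists of the arcs out of [x] and [m x]. *)
Definition arc (u v : V) := (v == m u) || left u v.

Definition double_star (x : V) : {set {set V}} :=
  [set e | [exists u, exists v,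
     [&& e == [set u; v], u \in [set x; m x] & arc u v]]].

Lemma arc_neq u v : arc u v -> u != v.
Proof.
rewrite /arc; case: eqP => [->|_] /= h; first by rewrite eq_sym m_neq.
by apply: contraTneq h => ->; rewrite leftxx.
Qed.

Lemma m_eq x y : (m x == y) = (x == m y).
Proof. by apply/eqP/eqP => [<-|->]; rewrite mK. Qed.

Lemma arc_swap u v : u != v -> v != m u -> arc v u = ~~ arc u v.
Proof.
move=> uv vmu; rewrite /arc (negPf vmu) -m_eq eq_sym (negPf vmu) /=.
by rewrite left_swap // eq_sym.
Qed.

Lemma set2_inj (a b c d : V) : [set a; b] = [set c; d] ->
  (a = c /\ b = d) \/ (a = d /\ b = c).
Proof.
move=> e.
have: a \in [set c; d] by rewrite -e set21.
have: b \in [set c; d] by rewrite -e set22.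
have: c \in [set a; b] by rewrite e set21.
have: d \in [set a; b] by rewrite e set22.
rewrite !inE => /orP[]/eqP-> /orP[]/eqP-> /orP[]/eqP h1
  /orP[]/eqP h2; subst; auto.
Qed.

Lemma adj_double_star x u v : adj (double_star x) u v =
  ((u \in [set x; m x]) && arc u v) || ((v \in [set x; m x]) && arc v u).
Proof.
rewrite /adj inE; apply/existsP/orP => [[a /existsP[b /and3P[/eqP e ax ab]]]|].
  by case/set2_inj: e => -[-> ->]; [left|right]; apply/andP.
case=> /andP[h1 h2]; [exists u|exists v]; apply/existsP; [exists v|exists u].
  by rewrite eqxx h1.
by rewrite finset.setUC eqxx h1.
Qed.

Lemma double_starP x e : reflect
  (exists u v, [/\ e = [set u; v], u \in [set x; m x] & arc u v])
  (e \in double_star x).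
Proof.
rewrite inE; apply: (iffP existsP).
  by case=> u /existsP[v /and3P[/eqP-> ? ?]]; exists u, v.
by case=> u [v [-> h1 h2]]; exists u; apply/existsP; exists v; rewrite eqxx h1.
Qed.

Lemma double_star_m x : double_star (m x) = double_star x.
Proof. by apply/setP => e; rewrite !inE mK finset.setUC. Qed.

Lemma double_star_centre x u : u \in [set x; m x] ->
  double_star u = double_star x.
Proof. by rewrite !inE => /orP[]/eqP-> //; rewrite double_star_m. Qed.

Lemma double_star_edges x : double_star x \subset complete_edges V.
Proof.
apply/fintype.subsetP => e /double_starP[u [v [-> _ /arc_neq uv]]].
by rewrite inE cards2 uv.
Qed.

(* An edge avoiding the matching belongs to the star of exactly one of its ends;
   a matching edge determines its own star. *)
Lemma double_star_edge_inj x y e : e \in double_star x -> e \in double_star y ->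
  double_star x = double_star y.
Proof.
move=> /double_starP[u [v [-> ux uv]]] /double_starP[a [b [e1 ay ab]]].
rewrite -(double_star_centre ux) -(double_star_centre ay).
case/set2_inj: e1 => -[eu ev]; subst => //.
have [->|vmu] := eqVneq a (m b); first by rewrite double_star_m.
by move: ab; rewrite arc_swap ?uv // (arc_neq uv).
Qed.

Lemma double_star_edge x : [set x; m x] \in double_star x.
Proof.
by apply/double_starP; exists x, (m x); rewrite set21 /arc eqxx.
Qed.

Lemma double_star_cover e : e \in complete_edges V ->
  exists x, e \in double_star x.
Proof.
rewrite inE => /cards2P[u [v [uv ->]]].
have [->|vmu] := eqVneq v (m u); first by exists u; apply: double_star_edge.
have [a|/negPf a] := boolP (arc u v).
  by exists u; apply/double_starP; exists u, v; rewrite set21.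
exists v; apply/double_starP; exists v, u; rewrite set21 finset.setUC arc_swap //.
by rewrite a.
Qed.

Definition double_stars := double_star @: [set: V].

Lemma double_stars_partition : finset.partition double_stars (complete_edges V).
Proof.
apply/and3P; split.
- apply/eqP/setP => e; apply/bigcupP/idP => [[_ /imsetP[x _ ->]]|].
    exact: (fintype.subsetP (double_star_edges x)).
  by case/double_star_cover => x ex; exists (double_star x); rewrite ?imset_f.
- apply/finset.trivIsetP => _ _ /imsetP[x _ ->] /imsetP[y _ ->] nxy.
  rewrite -setI_eq0; apply: contraNT nxy => /set0Pn[e /setIP[ex ey]].
  by apply/eqP; apply: double_star_edge_inj ex ey.
- apply/imsetP => -[x _ e0].
  by have := double_star_edge x; rewrite -e0 inE.
Qed.

(** The matching edge at [x] lies in the tree of [y], so one of its ends is a centre of that tree,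
    and then both are. *)
Lemma double_star_inj x y : double_star x = double_star y -> x \in [set y; m y].
Proof.
move=> e; have := double_star_edge x; rewrite e.
move=> /double_starP[u [v [/set2_inj[][-> ev] uy _]]] //.
move: uy; rewrite -ev !inE -!m_eq !mK.
by case/orP => /eqP->; rewrite ?mK ?eqxx ?orbT.
Qed.

(** The map [double_star] is two-to-one: its fibres are the matched pairs. *)
Lemma card_double_stars : #|V| = (#|double_stars|).*2.
Proof.
rewrite -cardsT -sum1_card (partition_big_imset double_star) /= -muln2 -sum_nat_const.
apply: eq_bigr => _ /imsetP[x _ ->].
rewrite sum1_card -[RHS](_ : #|[set x; m x]| = 2%N); last first.
  by rewrite cards2 eq_sym m_neq.
apply: eq_card => y; rewrite [in LHS]unfold_in inE /=; apply/eqP/idP.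
  exact: double_star_inj.
exact: double_star_centre.
Qed.

Lemma double_star_sym x : symmetric (adj (double_star x)).
Proof. by move=> u v; rewrite /adj finset.setUC. Qed.

Lemma left_centre x u : u \in [set x; m x] -> left x u = false.
Proof. by rewrite !inE => /orP[]/eqP->. Qed.

Definition centre_of x y := if left x y then x else m x.

Lemma centre_of_centre x y : centre_of x y \in [set x; m x].
Proof. by rewrite /centre_of; case: ifP; rewrite !inE eqxx ?orbT. Qed.

Lemma leaf_neq x y : (y \notin [set x; m x]) = (y != x) && (y != m x).
Proof. by rewrite !inE negb_or. Qed.

(** A leaf can only be the head of an arc from a centre, and by [left_opp] it is to the left of
    exactly one of the two centres. *)
Lemma adj_leaf x y z : y \notin [set x; m x] ->
  adj (double_star x) y z = (z == centre_of x y).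
Proof.
move=> yx; have /andP[yx1 yx2] : (y != x) && (y != m x) by rewrite -leaf_neq.
rewrite /centre_of adj_double_star (negPf yx) /= !inE /arc.
have [zx|] := eqVneq z x; [|have [zm _|zm zx] := eqVneq z (m x)].
- subst z; rewrite (negPf yx2) /=; case: ifP => _.
    by rewrite eqxx.
  by rewrite eq_sym (negPf (m_neq x)).
- subst z; rewrite mK (negPf yx1) /= left_opp //; case: ifP => _ /=.
    by rewrite (negPf (m_neq x)).
  by rewrite eqxx.
- by rewrite /=; case: ifP; rewrite ?(negPf zm) ?(negPf zx).
Qed.

Lemma double_star_connect x y : connect (adj (double_star x)) x y.
Proof.
have xm : connect (adj (double_star x)) x (m x).
  by apply: connect1; rewrite /adj double_star_edge.
have xc c : c \in [set x; m x] -> connect (adj (double_star x)) x c.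
  by rewrite !inE => /orP[]/eqP->.
have [/xc//|yx] := boolP (y \in [set x; m x]).
apply: connect_trans (xc _ (centre_of_centre x y)) (connect1 _).
by rewrite double_star_sym adj_leaf.
Qed.

(** On a cycle of length above 2 every vertex has two distinct neighbours, so no leaf lies on it;
    the two centres alone are too few. *)
Lemma double_star_acyclic x : acyclic (double_star x).
Proof.
move=> c c2; apply/negP => /andP[cyc uc].
have sub : {subset c <= [set x; m x]}.
  move=> y yc; apply: contraT => yx.
  have e z := adj_leaf z yx.
  (* With the cycle rotated to start at the leaf [y], its second and last vertices are both the one
     neighbour of [y], against uniqueness. *)
  have [i c' ec] := rot_to yc.
  move: cyc; rewrite -(rot_cycle i) ec /= rcons_path => /andP[+ last_y].
  have := uc; rewrite -(rot_uniq i) ec /=.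
  have : size (y :: c') = size c by rewrite -ec size_rot.
  case: c' last_y {ec} => [|a c']; first by case: (c) c2 => [|? []].
  case/lastP: c' => [|c' b]; first by case: (c) c2 => [|? [|? []]].
  rewrite /= last_rcons double_star_sym !e => /eqP-> _.
  move=> /and3P[_ na _] /andP[/eqP az _].
  by move: na; rewrite az mem_rcons inE eqxx.
have: (size c <= size (enum [set x; m x]))%N.
  by apply: uniq_leq_size => // y /sub; rewrite mem_enum.
by rewrite -cardE cards2 eq_sym m_neq leqNgt c2.
Qed.

Lemma double_star_spanning x : spanning_tree (double_star x).
Proof.
split; [exact: double_star_edges| |exact: double_star_acyclic].
move=> y z; apply: connect_trans (double_star_connect x z).
by rewrite (sym_connect_sym (@double_star_sym x)) double_star_connect.
Qed.

(** A centre has degree [k + 1], from its partner and the [k] vertices on its left; [k > 0] keeps it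
    from being 1. *)
Lemma degree_double_star x y :
  (degree (double_star x) y != 1%N) = (y \in [set x; m x]).
Proof.
have [yx|yx] := boolP (y \in [set x; m x]); last first.
  rewrite /degree (_ : [set z | _] = [set centre_of x y]) ?cards1 //.
  by apply/setP => z; rewrite !inE adj_leaf.
rewrite -(double_star_centre yx) /degree.
rewrite (_ : [set z | _] = m y |: [set z | left y z]).
  by rewrite cardsU1 inE leftxm card_left /=; case: k k_gt0.
apply/setP => z; rewrite !inE adj_double_star !inE eqxx /= /arc.
case: (eqVneq z (m y)) => [//|zm]; case: (eqVneq z y) => [->|_] /=.
  by rewrite eq_sym (negPf (m_neq y)) leftxx.
by rewrite orbF.
Qed.

Lemma double_star_caterpillar x : caterpillar (double_star x).
Proof.
rewrite /caterpillar.
have -> : [set y | degree (double_star x) y != 1%N] = [set x; m x].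
  by apply/setP => y; rewrite inE degree_double_star.
exists [:: x; m x]; split.
- by rewrite /= inE eq_sym m_neq.
- by apply/setP => y; rewrite !inE.
apply/setP => e; apply/idP/imsetP => [|[u us ->]].
  rewrite inE => /andP[/double_starP[u [v [-> ux uv]]] /fintype.subsetP sub].
  exists (x, m x); rewrite ?inE //=.
  have := arc_neq uv; have := sub v (set22 _ _); move: ux; rewrite !inE.
  by case/orP => /eqP-> /orP[] /eqP->; rewrite ?eqxx // finset.setUC.
by move: us; rewrite /= inE => /eqP->; rewrite inE double_star_edge /=.
Qed.

Lemma adj_centres x u v : u \in [set x; m x] -> v \in [set x; m x] ->
  adj (double_star x) u v = (u != v).
Proof.
move=> ux vx; rewrite adj_double_star ux vx /=.
have [->|uv] := eqVneq u v; first by rewrite orbb; apply/negP => /arc_neq/eqP.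
suff vm : v = m u by rewrite /arc vm eqxx.
move: ux vx uv; rewrite !inE => /orP[]/eqP-> /orP[]/eqP->; rewrite ?eqxx //.
Qed.

(** Centres go to centres, left leaves to left leaves by [f], and right leaves, which are the left
    leaves of [m x], to right leaves by [g]. All these leaf sets have size [k]. *)
Lemma double_star_isomorphic x y : isomorphic (double_star x) (double_star y).
Proof.
have [f [fI fE]] :=
  equicardinal_bijection (etrans (card_left x) (esym (card_left y))).
have [g [gI gE]] :=
  equicardinal_bijection (etrans (card_left (m x)) (esym (card_left (m y)))).
pose h z := if z == x then y else if z == m x then m y else
  if left x z then f z else g z.
have hx : h x = y by rewrite /h eqxx.
have hm : h (m x) = m y by rewrite /h eqxx (negPf (m_neq x)).
have hL z : left x z -> h z = f z.
  rewrite /h => xz; have [zx|_] := eqVneq z x; first by rewrite zx leftxx in xz.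
  have [zx|_] := eqVneq z (m x); first by rewrite zx leftxm in xz.
  by rewrite xz.
have hR z : z \notin [set x; m x] -> ~~ left x z -> h z = g z.
  by rewrite leaf_neq /h => /andP[/negPf-> /negPf->] /negPf->.
have fL z : left x z -> left y (f z).
  move=> xz; have: f z \in f @: [set t | left x t] by rewrite imset_f ?inE.
  by rewrite fE inE.
have gR z : z \notin [set x; m x] -> ~~ left x z -> left (m y) (g z).
  rewrite leaf_neq => /andP[zx zm] xz.
  have: g z \in g @: [set t | left (m x) t] by rewrite imset_f ?inE ?left_opp.
  by rewrite gE inE.
have leftN u v : left u v -> v \notin [set u; m u].
  by move=> uv; apply: contraTN uv => /left_centre->.
have hleaf z : z \notin [set x; m x] ->
    h z \notin [set y; m y] /\ left y (h z) = left x z.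
  move=> zx; have [xz|xz] := boolP (left x z).
    by rewrite hL // fL // leftN // fL.
  rewrite (hR _ zx xz); have yg := gR _ zx xz; have := leftN _ _ yg.
  rewrite mK finset.setUC => gy; split=> //.
  by move: gy; rewrite leaf_neq => /andP[? ?]; apply: negbTE; rewrite -left_opp.
have hcent z : (h z \in [set y; m y]) = (z \in [set x; m x]).
  have [|zx] := boolP (z \in [set x; m x]).
    by rewrite !inE => /orP[]/eqP->; rewrite ?hx ?hm eqxx ?orbT.
  by have [/negPf-> _] := hleaf _ zx.
have hI : injective h.
  move=> u v e; have := hcent v; rewrite -e hcent.
  have [ux /esym vx|ux /esym/negbT vx] := boolP (u \in [set x; m x]).
    move: ux vx e; rewrite !inE => /orP[]/eqP-> /orP[]/eqP-> //;
      rewrite hx hm => /eqP.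
      by rewrite eq_sym (negPf (m_neq y)).
    by rewrite (negPf (m_neq y)).
  have := (hleaf _ vx).2; rewrite -e (hleaf _ ux).2.
  have [xu /esym xv|xu /esym/negbT xv] := boolP (left x u).
    by apply: fI; rewrite ?inE // -!hL.
  move: (ux) (vx); rewrite 2!leaf_neq => /andP[? ?] /andP[? ?].
  by apply: gI; rewrite ?inE ?left_opp // -!hR.
(* The side of a leaf determines its neighbour, and [h] preserves sides. *)
have hadj u v : u \notin [set x; m x] ->
    adj (double_star x) u v = adj (double_star y) (h u) (h v).
  move=> ux; have [hu e] := hleaf _ ux.
  rewrite !adj_leaf // -(inj_eq hI) /centre_of e; congr (_ == _).
  by case: ifP; rewrite ?hx ?hm.
exists h; split.
- by move=> u v _ _ /hI.
- apply/eqP; rewrite eqEcard finset.subsetT /= card_imset //.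
move=> u v _ _; have [ux|/hadj//] := boolP (u \in [set x; m x]).
have [vx|/hadj e] := boolP (v \in [set x; m x]); last first.
  by rewrite double_star_sym e double_star_sym.
by rewrite !adj_centres ?hcent // (inj_eq hI).
Qed.

Definition half_star x := double_star x :\ [set x; m x].

Lemma half_star_m x : half_star (m x) = half_star x.
Proof. by rewrite /half_star double_star_m mK finset.setUC. Qed.

Lemma half_star_sym x : symmetric (adj (half_star x)).
Proof. by move=> u v; rewrite /adj finset.setUC. Qed.

Lemma adj_half_star x v : adj (half_star x) x v = left x v.
Proof.
rewrite /adj /half_star in_setD1 -/(adj _ _ _).
have [vx|vx] := boolP (v \in [set x; m x]).
  rewrite adj_centres ?set21 // left_centre //.
  by move: vx; rewrite !inE => /orP[]/eqP->; rewrite eqxx ?andbF.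
rewrite double_star_sym adj_leaf // /centre_of.
case: ifP => [xv|]; last by rewrite [x == _]eq_sym (negPf (m_neq x)) andbF.
rewrite eqxx andbT; apply: contraNneq vx => e.
by rewrite -e set22.
Qed.

(** Without the central edge, the left leaves of [x] have only [x] as neighbour, so this set is
    closed under adjacency; all its other members are adjacent to [x]. *)
Lemma component_half_star x :
  component (half_star x) x = x |: [set y | left x y].
Proof.
have cl : closed (adj (half_star x)) (x |: [set y | left x y]).
  apply: intro_closed; first exact/sym_connect_sym/half_star_sym.
  move=> u v uv; rewrite !inE => /orP[/eqP ux|xu].
    by move: uv; rewrite ux adj_half_star => ->; rewrite orbT.
  have ux : u \notin [set x; m x] by apply: contraTN xu => /left_centre->.
  move: uv; rewrite /adj in_setD1 -/(adj _ _ _) => /andP[_].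
  by rewrite adj_leaf // /centre_of xu => ->.
apply/setP => z; rewrite inE; apply/idP/idP => [/(closed_connect cl)<-|].
  by rewrite !inE eqxx.
rewrite !inE => /orP[/eqP->//|xz]; apply: connect1.
by rewrite adj_half_star.
Qed.

Lemma adj_component_half_star x u v : let W := component (half_star x) x in
  u \in W -> v \in W ->
  adj (half_star x ::&: W) u v = ((u == x) && left x v) || ((v == x) && left x u).
Proof.
move=> W uW vW.
rewrite /adj inE finset.subUset !finset.sub1set uW vW !andbT -/(adj _ _ _).
move: uW vW; rewrite /W component_half_star !inE.
have [-> _ _|ux /= xu vW] := eqVneq u x.
  by rewrite adj_half_star leftxx andbF orbF /=.
have [->|vx /=] := eqVneq v x; first by rewrite half_star_sym adj_half_star.
have un : u \notin [set x; m x] by apply: contraTN xu => /left_centre->.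
by rewrite /adj in_setD1 -/(adj _ _ _) adj_leaf // /centre_of xu (negPf vx) andbF.
Qed.

(** Cutting the central edge leaves two stars with [k] leaves each; any bijection of the leaves
    extends to an isomorphism exchanging the centres. *)
Lemma double_star_symmetric x : symmetric_tree (double_star x).
Proof.
exists x, (m x); split; first exact: double_star_edge.
rewrite /= -/(half_star x).
have [f [fI fE]] :=
  equicardinal_bijection (etrans (card_left x) (esym (card_left (m x)))).
pose h z := if z == x then m x else f z.
have fL z : left x z -> left (m x) (f z).
  move=> xz; have: f z \in f @: [set t | left x t] by rewrite imset_f ?inE.
  by rewrite fE inE.
have hL z : left x z -> h z = f z.
  by rewrite /h; case: eqVneq => [->|//]; rewrite leftxx.
have hW : h @: component (half_star x) x = component (half_star x) (m x).
  rewrite -{2}half_star_m !component_half_star finset.imsetU1 {1}/h eqxx; congr (_ |: _).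
  by rewrite -fE; apply: eq_in_imset => z; rewrite inE => /hL.
have hc u : u \in component (half_star x) x ->
    (h u == m x) = (u == x) /\ left (m x) (h u) = left x u.
  rewrite component_half_star !inE => /orP[/eqP->|xu].
    by rewrite /h !eqxx !leftxx.
  rewrite hL // fL // xu; split=> //.
  have [ux|_] := eqVneq u x; first by rewrite ux leftxx in xu.
  by apply: contraTF (fL _ xu) => /eqP->; rewrite leftxx.
exists h; last by rewrite /h eqxx.
split=> // u v uW vW; have [u1 u2] := hc _ uW; have [v1 v2] := hc _ vW.
  move=> e; move: v1 uW vW; rewrite -e u1 component_half_star !inE.
  have [-> /esym/eqP //|ux /esym/negbT vx /= xu] := eqVneq u x.
  by rewrite (negPf vx) => xv; apply: fI; rewrite ?inE // -!hL.
have hu : h u \in component (half_star (m x)) (m x).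
  by rewrite half_star_m -hW imset_f.
have hv : h v \in component (half_star (m x)) (m x).
  by rewrite half_star_m -hW imset_f.
rewrite adj_component_half_star // -(half_star_m x) adj_component_half_star //.
by rewrite u1 u2 v1 v2.
Qed.

End DoubleStars.

(** * Level crossings of affine functions of time *)

Lemma seq_min d (T : orderType d) (s : seq T) (x0 : T) : x0 \in s ->
  exists2 x, x \in s & {in s, forall y, x <= y}%O.
Proof.
elim: s x0 => //= a s IH x0 _; case: s IH => [_|b s /(_ b)].
  by exists a; rewrite ?mem_head // => y; rewrite inE => /eqP->.
rewrite mem_head => /(_ isT)[x xs xmin].
have [ax|xa] := leP a x.
  exists a; rewrite ?mem_head // => y; rewrite inE => /orP[/eqP->//|/xmin].
  exact: le_trans.
exists x; first by rewrite inE xs orbT.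
by move=> y; rewrite inE => /orP[/eqP->|/xmin//]; apply: ltW.
Qed.

Section AffineLevel.
Local Open Scope set_scope.
Variables (R : realFieldType) (I : finType) (Z : {set I}) (p q : I -> R).
Variable (k : nat).
Let g (t : R) z := (1 - t) * p z + t * q z.
Hypothesis simple_root : forall t y z, 0 <= t < 1 -> y \in Z -> z \in Z ->
  g t y = 0 -> g t z = 0 -> y = z.
Hypothesis low : (#|[set z in Z | (0 <= p z)%R]| <= k)%N.
Hypothesis high : (k.+1 < #|[set z in Z | (0 < q z)%R]|)%N.

(* At the least time at which more than [k.+1] of the functions are nonnegative,
   one of them has just reached 0 and exactly [k.+1] others are positive. *)
Lemma affine_level : exists t z,
  [/\ 0 <= t < 1, z \in Z, g t z = 0 & #|[set y in Z | (0 < g t y)%R]| = k.+1].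
Proof.
pose nn t := #|[set z in Z | (0 <= g t z)%R]|.
(* Signs can change only at roots, so the end times and the roots are the only candidates. *)
pose times := [:: 0, 1 & [seq p z / (p z - q z) | z <- enum Z]].
pose late t := [&& 0 <= t <= 1 & (k.+1 < nn t)%N].
have late1 : late 1.
  rewrite /late ler01 lexx /=; apply: leq_trans high _.
  apply: subset_leq_card; apply/fintype.subsetP => z; rewrite !inE /g.
  by rewrite subrr mul0r add0r mul1r => /andP[-> /ltW].
have [|t] := @seq_min _ R [seq t <- times | late t] 1.
  by rewrite mem_filter late1 !inE eqxx orbT.
rewrite mem_filter => /andP[/andP[/andP[t0 t1] nnt] tT] tmin.
have nn0 : (nn 0%R <= k)%N.
  rewrite (leq_trans _ low) // subset_leq_card //.
  by apply/fintype.subsetP => z; rewrite !inE /g subr0 mul1r mul0r addr0.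
have {}t0 : 0 < t.
  by rewrite lt_neqAle t0 andbT; apply: contraTneq nnt => <-; rewrite -leqNgt ltnW.
(* The minimum in the dual order is the last candidate time [s] before [t]; it is not late. *)
have [|s] := @seq_min _ (R^d)%type [seq s <- times | 0 <= s < t] 0.
  by rewrite mem_filter lexx t0 mem_head.
rewrite mem_filter => /andP[/andP[s0 st] sT] smax.
have nns : (nn s <= k.+1)%N.
  rewrite leqNgt; apply/negP => ls; suff : t <= s by rewrite leNgt st.
  by apply: tmin; rewrite mem_filter sT /late ls s0 (ltW (lt_le_trans st t1)).
(* A function positive at [t] but negative at [s] would have a root strictly between them, against
   the choice of [s]. *)
have post : (#|[set z in Z | (0 < g t z)%R]| <= k.+1)%N.
  apply: leq_trans nns; apply: subset_leq_card; apply/fintype.subsetP => z.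
  rewrite !inE => /andP[zZ gt]; rewrite zZ /= leNgt; apply/negP => gs.
  have pq : 0 < q z - p z by move: gt gs st; rewrite /g; nra.
  pose u := p z / (p z - q z).
  have uE : u = - p z / (q z - p z) by rewrite -(opprB (p z)) invrN mulrNN.
  have su : s < u by rewrite uE ltr_pdivlMr //; move: gs; rewrite /g; lra.
  have ut : u < t by rewrite uE ltr_pdivrMr //; move: gt; rewrite /g; lra.
  suff : u <= s by rewrite leNgt su.
  apply: smax; rewrite mem_filter ut (ltW (le_lt_trans s0 su)) !inE /=.
  by rewrite (map_f (fun z => p z / (p z - q z))) ?mem_enum ?orbT.
have {}t1 : t < 1.
  rewrite lt_neqAle t1 andbT; apply: contraTneq post => t1'.
  rewrite -ltnNge (leq_trans high) // subset_leq_card //.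
  apply/fintype.subsetP => z.
  by rewrite !inE /g t1' subrr mul0r add0r mul1r.
have [z zZ tE] : exists2 z, z \in Z & t = p z / (p z - q z).
  move: tT; rewrite !inE (gt_eqF t0) (lt_eqF t1) /= => /mapP[z].
  by rewrite mem_enum => ? ?; exists z.
have gz : g t z = 0.
  (* As inversion sends 0 to 0, a zero denominator would make [t] zero. *)
  have pq : p z - q z != 0.
    by apply: contraTneq t0 => pq; rewrite tE pq invr0 mulr0 ltxx.
  by rewrite /g tE; field.
exists t, z; split=> //; first by rewrite (ltW t0).
apply/eqP; rewrite eqn_leq post /=; move: nnt; rewrite /nn.
rewrite (cardsD1 z) !inE zZ gz lexx ltnS /=.
move/leq_trans; apply; apply: subset_leq_card; apply/fintype.subsetP => y.
rewrite !inE => /and3P[yz yZ gy]; rewrite yZ lt_neqAle gy andbT.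
apply: contraNneq yz => gy0; apply/eqP.
by apply: (@simple_root t) => //; rewrite ltW.
Qed.

End AffineLevel.

(** * Orientation determinants and affine functions on the plane *)

Section Orientation.
Variable R : realType.
Implicit Types p q z w : 'rV[R]_2.

Lemma point_eqP p q : p 0 0 = q 0 0 -> p 0 1 = q 0 1 -> p = q.
Proof.
move=> e0 e1; apply/rowP => -[[|[|//]] i2].
  by rewrite (_ : Ordinal i2 = 0) //; apply: val_inj.
by rewrite (_ : Ordinal i2 = 1) //; apply: val_inj.
Qed.

Lemma orientC p q z : orient q p z = - orient p q z.
Proof. rewrite /orient; ring. Qed.

Lemma orientxx p q : orient p q p = 0.
Proof. rewrite /orient; ring. Qed.

Lemma orientxy p q : orient p q q = 0.
Proof. rewrite /orient; ring. Qed.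

(** Both sides are the determinant of [q - p] and [z - w]. *)
Lemma orient4 p q z w :
  orient p q z - orient p q w = orient z w q - orient z w p.
Proof. rewrite /orient; ring. Qed.

Definition affine (g : 'rV[R]_2 -> R) :=
  exists a b c, forall z, g z = a * z 0 0 + b * z 0 1 + c.

Lemma affine_orient_line p q : affine (orient p q).
Proof.
exists (- (q 0 1 - p 0 1)), (q 0 0 - p 0 0).
exists ((q 0 1 - p 0 1) * p 0 0 - (q 0 0 - p 0 0) * p 0 1) => z.
by rewrite /orient; ring.
Qed.

Lemma affine_comb g h s t : affine g -> affine h ->
  affine (fun z => s * g z + t * h z).
Proof.
move=> [a [b [c e]]] [a' [b' [c' e']]].
exists (s * a + t * a'), (s * b + t * b'), (s * c + t * c') => z.
by rewrite e e'; ring.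
Qed.

(** The gradient of [g] is orthogonal to [q - p], hence proportional to that of [orient p q]; the
    factor is read off a coordinate in which [p] and [q] differ. *)
Lemma affine_vanishing g p q : affine g -> p != q -> g p = 0 -> g q = 0 ->
  exists c, forall z, g z = c * orient p q z.
Proof.
move=> [a [b [c e]]] pq gp gq.
have d : a * (q 0 0 - p 0 0) + b * (q 0 1 - p 0 1) = 0.
  by move: gp gq; rewrite !e; lra.
have ez z : g z = a * (z 0 0 - p 0 0) + b * (z 0 1 - p 0 1).
  by move: gp; rewrite !e; lra.
have [d0|d0] := eqVneq (q 0 0 - p 0 0) 0; last first.
  exists (b / (q 0 0 - p 0 0)) => z; rewrite ez /orient.
  have -> : a = - b * (q 0 1 - p 0 1) / (q 0 0 - p 0 0).
    by apply: (mulIf d0); rewrite mulfVK //; lra.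
  by field.
have [d1|d1] := eqVneq (q 0 1 - p 0 1) 0.
  by case/eqP: pq; apply: point_eqP; lra.
exists (- a / (q 0 1 - p 0 1)) => z; rewrite ez /orient d0.
have -> : b = 0 by apply: (mulIf d1); move: d; rewrite d0; lra.
by field.
Qed.

End Orientation.

(** * Any two halving pairs cross *)

Section HalvingPairs.
Local Open Scope set_scope.
Variables (R : realType) (P : {fset 'rV[R]_2}) (n : nat).
Hypothesis card_P : #|` P| = (2 * n)%N.
Hypothesis gen : general_position P.
Implicit Types x y z w : P.

Local Notation o x y z := (orient (val x) (val y) (val z)).

Lemma val_neq x y : (val x != val y) = (x != y).
Proof. by rewrite (inj_eq val_inj). Qed.

Lemma orient_neq0 x y z : x != y -> x != z -> y != z -> o x y z != 0.
Proof.
rewrite -!val_neq => xy xz yz; apply/eqP.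
exact: gen (valP x) (valP y) (valP z) xy xz yz.
Qed.

Lemma orient_eq0 x y z : x != y -> (o x y z == 0) = (z \in [set x; y]).
Proof.
move=> xy; have [|] := boolP (z \in [set x; y]); rewrite !inE.
  by case/orP => /eqP->; rewrite ?orientxx ?orientxy eqxx.
rewrite negb_or ![z == _]eq_sym => /andP[xz yz]; apply: negbTE.
exact: orient_neq0.
Qed.

Definition left_set x y := [set z : P | (0 < o x y z)%R].

Lemma card_sides x y : x != y ->
  (#|left_set x y| + #|left_set y x| + 2)%N = (2 * n)%N.
Proof.
move=> xy; rewrite -card_P cardfE -cardsT.
have posneg : left_set x y :&: left_set y x = finset.set0.
  apply/setP => z; rewrite !inE (orientC (val x) (val y)) oppr_gt0.
  by case: ltgtP.
have nonzero : (left_set x y :|: left_set y x) :&: [set x; y] = finset.set0.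
  apply/setP => z; rewrite finset.in_setI -(orient_eq0 _ xy) !inE.
  rewrite (orientC (val x) (val y)).
  by case: eqP => [->|]; rewrite ?andbF // oppr_gt0 ltxx.
have -> : [set: P] = (left_set x y :|: left_set y x) :|: [set x; y].
  apply/setP => z; rewrite 2!finset.in_setU -(orient_eq0 _ xy) !inE.
  rewrite (orientC (val x) (val y)) oppr_gt0.
  by case: ltgtP.
by rewrite cardsU nonzero cardsU posneg !cards0 !subn0 cards2 xy.
Qed.

(** Counting one side is enough, since [card_sides] then gives [n.-1] points on the other. *)
Definition halves x y := (x != y) && (#|left_set x y| == n.-1).

Lemma halves_sym x y : halves x y -> halves y x.
Proof.
move=> /andP[xy /eqP c]; rewrite /halves eq_sym xy /=.
apply/eqP; have := card_sides xy; rewrite c.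
move: #|_| => u; lia.
Qed.

Hypothesis partner_unique : forall x y z, halves x y -> halves x z -> y = z.

(** The turning line of the idea is the zero line of an affine function, and [affine_level] finds
    the time at which it halves the points. *)
Lemma halving_pair_not_left x x' y y' : halves x x' -> halves y y' ->
  (0 < o x x' y)%R -> (o x x' y < o x x' y')%R -> False.
Proof.
move=> hx hy b1 b2.
have yy' : y != y' by apply: contraTneq b2 => ->; rewrite ltxx.
have vyy : val y != val y' by rewrite val_neq.
have b3 := lt_trans b1 b2.
pose p z := (o x x' z - o x x' y)%R.
pose q z := o y y' z.
(* The line [g t = 0] turns about [y] from the parallel to [xx'] at time 0 to the line [yy'] at time
   1, and [y'] is on its positive side before time 1. *)
pose g (t : R) (w : 'rV[R]_2) := (((1 - t) * (orient (val x) (val x') w - o x x' y))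
  + t * orient (val y) (val y') w)%R.
have ag t : affine (g t).
  apply: affine_comb; last exact: affine_orient_line.
  have [a [b [c e]]] := affine_orient_line (val x) (val x').
  by exists a, b, (c - o x x' y)%R => z; rewrite e addrA.
have gy t : g t (val y) = 0 by rewrite /g subrr orientxx; ring.
have gy' t : (t < 1)%R -> (0 < g t (val y'))%R.
  move=> t1; rewrite /g orientxy mulr0 addr0 mulr_gt0 // subr_gt0 //.
pose Z := ~: [set y; y'].
have Zneq z : z \in Z -> y != z /\ y' != z.
  by rewrite !inE negb_or ![z == _]eq_sym => /andP.
have cx : #|left_set x x'| = n.-1 by case/andP: hx => _ /eqP.
have cy : #|left_set y y'| = n.-1 by case/andP: hy => _ /eqP.
(* Among the [n.-1] points to the left of [xx'] are [y] and [y'], which [Z] omits. *)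
have low : (#|[set z in Z | (0 <= p z)%R]| <= n.-1 - 2)%N.
  rewrite -cx; have /leq_trans : (#|[set z in Z | (0 <= p z)%R]| <=
    #|left_set x x' :\: [set y; y']|)%N.
    apply: subset_leq_card; apply/fintype.subsetP => z; rewrite !inE.
    move=> /andP[-> ]; rewrite /p subr_ge0 /=.
    exact: lt_le_trans.
  apply; rewrite cardsD (finset.setIidPr _) ?cards2 ?yy' //.
  by apply/fintype.subsetP => z; rewrite !inE => /orP[]/eqP->.
(* This makes the truncated difference [n.-1 - 2] exact. *)
have n3 : (2 <= n.-1)%N.
  rewrite -cx; apply: (@leq_trans #|[set y; y']|); first by rewrite cards2 yy'.
  apply: subset_leq_card.
  by apply/fintype.subsetP => z; rewrite !inE => /orP[]/eqP->.
have high : ((n.-1 - 2).+1 < #|[set z in Z | (0 < q z)%R]|)%N.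
  have -> : [set z in Z | (0 < q z)%R] = left_set y y'.
    apply/setP => z; rewrite !inE /q andb_idl // => qz.
    by apply: contraTN qz => /orP[]/eqP->; rewrite ?orientxx ?orientxy ltxx.
  by rewrite cy; clear -n3; lia.
have [|t [z [t01 zZ gz cg]]] := affine_level _ low high.
  (* If [a] and [b] differed, the zero line would hold three points of [P], forcing [g t] to vanish
     identically, also at [y']. *)
  move=> t a b /andP[_ t1] /Zneq[ya _] /Zneq[yb _] ga gb.
  apply/eqP; apply: contraT => ab.
  have vya : val y != val a by rewrite val_neq.
  have [c e] := affine_vanishing (ag t) vya (gy t) ga.
  have := e (val b); rewrite [LHS]gb => /esym/eqP.
  rewrite mulf_eq0 (negPf (orient_neq0 ya yb ab)) orbF => /eqP c0.
  by have := gy' _ t1; rewrite e c0 mul0r ltxx.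
have {t01} t1 : (t < 1)%R by case/andP: t01.
have [yz y'z] := Zneq _ zZ; have vyz : val y != val z by rewrite val_neq.
have [c e] := affine_vanishing (ag t) vyz (gy t) gz.
(* The level in [Z] is one below [n.-1], and [y'] supplies the missing point. *)
have cpos : #|[set w : P | (0 < g t (val w))%R]| = n.-1.
  have -> : [set w : P | (0 < g t (val w))%R] = y' |: [set w in Z | (0 < g t (val w))%R].
    apply/setP => w; rewrite !inE.
    have [->|wy'] := eqVneq w y'; first by rewrite gy'.
    by have [->|wy //] := eqVneq w y; rewrite gy ltxx.
  rewrite cardsU1 cg !inE eqxx orbT /=; clear -n3; lia.
have c0 : c != 0%R.
  by apply: contraTneq (gy' _ t1) => c0; rewrite e c0 mul0r ltxx.
(* The line through [y] and [z] halves, so [z] would be the partner [y'], which is not in [Z]. The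
   sign of [c] only tells which side of the line is positive. *)
suff : halves y z by move/(partner_unique hy)/eqP; rewrite (negPf y'z).
have [cp|cn] : (0 < c)%R \/ (c < 0)%R by apply/orP; rewrite -neq_lt eq_sym.
  rewrite /halves yz /= -cpos; apply/eqP/eq_card => w.
  by rewrite !inE e pmulr_rgt0.
apply: halves_sym; rewrite /halves eq_sym yz /= -cpos; apply/eqP/eq_card => w.
by rewrite !inE e nmulr_rgt0 // orientC oppr_gt0.
Qed.

(** Here [yy'] is parallel to [xx'] and to its left, so one of its sides contains the [n.-1] points
    to the right of [xx'] and also [x]: too many. *)
Lemma halving_pair_not_parallel x x' y y' : halves x x' -> halves y y' ->
  (0 < o x x' y)%R -> o x x' y = o x x' y' -> False.
Proof.
move=> hx hy b1 b2; have yy' : y != y' by case/andP: hy.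
have vyy : val y != val y' by rewrite val_neq.
pose g (w : 'rV[R]_2) := (orient (val x) (val x') w - o x x' y)%R.
have ag : affine g.
  have [a [b [c e]]] := affine_orient_line (val x) (val x').
  by exists a, b, (c - o x x' y)%R => z; rewrite /g e addrA.
have gy : g (val y) = 0 by rewrite /g subrr.
have gy' : g (val y') = 0 by rewrite /g b2 subrr.
have [c e] := affine_vanishing ag vyy gy gy'.
have gneg : (n.-1 < #|[set w : P | (g (val w) < 0)%R]|)%N.
  have <- : #|left_set x' x| = n.-1 by case/andP: (halves_sym hx) => _ /eqP.
  apply: proper_card; apply/properP; split.
    apply/fintype.subsetP => w; rewrite !inE /g orientC; lra.
  exists x; first by rewrite inE /g orientxx; lra.
  by rewrite inE orientxy ltxx.
have c0 : c != 0%R.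
  apply: contraTneq b1 => c0; have := e (val x); rewrite c0 mul0r /g orientxx.
  by lra.
have [cp|cn] : (0 < c)%R \/ (c < 0)%R by apply/orP; rewrite -neq_lt eq_sym.
  have /andP[_ /eqP cy] := halves_sym hy.
  move: gneg; rewrite -cy ltnNge => /negP; apply; apply: subset_leq_card.
  apply/fintype.subsetP => w; rewrite !inE e pmulr_rlt0 //.
  by rewrite (orientC (val y)) oppr_gt0.
have /andP[_ /eqP cy] := hy.
move: gneg; rewrite -cy ltnNge => /negP; apply; apply: subset_leq_card.
by apply/fintype.subsetP => w; rewrite !inE e nmulr_rlt0.
Qed.

(** If [y] and [y'] were both on the left, comparing their distances to [xx'] would lead to one of
    the two lemmas above, up to exchanging [y] and [y']. Reversing [xx'] treats the right side. *)
Lemma halving_pairs_cross x x' y y' : halves x x' -> halves y y' ->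
  y \notin [set x; x'] -> (o x x' y' < 0)%R = (0 < o x x' y)%R.
Proof.
move=> hx hy yx.
have xx' : x != x' by case/andP: hx.
have y'x : y' \notin [set x; x'].
  apply: contra yx; rewrite !inE => /orP[]/eqP e; move: hy => /halves_sym; rewrite e.
    by move/(partner_unique hx) <-; rewrite eqxx orbT.
  by move/(partner_unique (halves_sym hx)) <-; rewrite eqxx.
have notleft u u' v v' : halves u u' -> halves v v' ->
    (0 < o u u' v)%R -> ~~ (0 < o u u' v')%R.
  move=> hu hv uv; apply/negP => uv'.
  have [] := ltgtP (o u u' v) (o u u' v').
  - exact: halving_pair_not_left hu hv uv.
  - exact: halving_pair_not_left hu (halves_sym hv) uv'.
  - exact: halving_pair_not_parallel hu hv uv.
have n0 : o x x' y != 0 by rewrite orient_eq0.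
have n0' : o x x' y' != 0 by rewrite orient_eq0.
have [h|h|/eqP h] := ltgtP 0%R (o x x' y); last by rewrite eq_sym (negPf n0) in h.
  by rewrite lt_neqAle n0' leNgt (notleft _ _ _ _ hx hy h).
apply: negbTE; rewrite -leNgt leNgt -[X in (X < 0)%R]opprK oppr_lt0 -orientC.
by rewrite (notleft _ _ _ _ (halves_sym hx) hy) // orientC oppr_gt0.
Qed.

End HalvingPairs.

(** * From halving lines to the matching, and planarity of its trees *)

Section HalvingLines.
Local Open Scope set_scope.
Variables (R : realType) (P : {fset 'rV[R]_2}) (n : nat).
Hypothesis card_P : #|` P| = (2 * n)%N.
Hypothesis gen : general_position P.
Implicit Types x y z : P.

Lemma card_fset_left x y :
  #|` [fset z in P | 0 < orient (val x) (val y) z]%fset| = #|left_set x y|.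
Proof.
rewrite -(@card_fsub _ P); last by apply/fsubsetP => z; rewrite !inE => /andP[].
by apply: eq_card => z; rewrite !inE (valP z).
Qed.

Lemma card_fset_right x y :
  #|` [fset z in P | orient (val x) (val y) z < 0]%fset| = #|left_set y x|.
Proof.
rewrite -card_fset_left; congr #|` _|; apply/fsetP => z.
by rewrite !inE /= orientC oppr_lt0.
Qed.

Lemma halves_line x y : halves n x y -> halving_line n P 0 (line (val x) (val y)).
Proof.
move=> h; exists (val x), (val y); split; first split=> //; try exact: valP.
  by rewrite (inj_eq val_inj); case/andP: h.
rewrite card_fset_left card_fset_right.
case/andP: (halves_sym card_P gen h) => _ /eqP->; case/andP: h => _ /eqP->.
by split; lia.
Qed.

(** By general position a point of [P] on the line must be one of the two points that define it. *)
Lemma line_halves x (L : set 'rV[R]_2) : halving_line n P 0 L -> L (val x) ->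
  exists y, halves n x y.
Proof.
move=> [p [q [[pP qP pq ->]]]]; pose a : P := [` pP]%fset; pose b : P := [` qP]%fset.
rewrite -[p]/(val a) -[q]/(val b) card_fset_left => -[ca _] xL.
have ab : a != b by rewrite -(inj_eq val_inj).
have hab : halves n a b by rewrite /halves ab ca /=; lia.
have := orient_eq0 gen x ab; rewrite xL eqxx => /esym; rewrite !inE.
case/orP => /eqP->; first by exists b.
by exists a; apply: halves_sym.
Qed.

Hypothesis one_halving_line :
  forall p, p \in P -> (halving_lines_at n P 0 p #= `I_1)%card.

Lemma halving_lines_at_unique p L1 L2 : p \in P ->
  halving_lines_at n P 0 p L1 -> halving_lines_at n P 0 p L2 -> L1 = L2.
Proof.
(* Removing one element [L] from a set of cardinality 1 leaves the empty set. *)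
move=> /one_halving_line /eq_cardSP[L _]; rewrite II0 card_eq0 => /eqP e h1 h2.
have eL K : halving_lines_at n P 0 p K -> K = L.
  move=> hK; apply/eqP; apply: contraT => /eqP KL.
  have : (halving_lines_at n P 0 p `\ L)%classic K by [].
  by rewrite e.
by rewrite (eL L1) // (eL L2).
Qed.

Lemma halves_unique x y z : halves n x y -> halves n x z -> y = z.
Proof.
move=> hy hz; have /andP[xy _] := hy; have /andP[xz _] := hz.
have e : line (val x) (val y) = line (val x) (val z).
  apply: (halving_lines_at_unique (valP x)); split.
  - exact: halves_line.
  - exact: orientxx.
  - exact: halves_line.
  - exact: orientxx.
have /eqP : line (val x) (val y) (val z) by rewrite e; exact: orientxy.
by rewrite orient_eq0 // !inE eq_sym (negPf xz) => /eqP.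
Qed.

Lemma halves_exists x : exists y, halves n x y.
Proof.
have /eq_cardSP[L [hL Lx] _] := one_halving_line (valP x).
exact: line_halves hL Lx.
Qed.

Definition partner x : P := xchoose (halves_exists x).

Lemma partnerP x : halves n x (partner x).
Proof. exact: xchooseP. Qed.

Lemma partnerK : involutive partner.
Proof.
move=> x; apply: halves_unique (partnerP _) _.
exact/halves_sym/partnerP.
Qed.

Lemma partner_neq x : partner x != x.
Proof. by rewrite eq_sym; case/andP: (partnerP x). Qed.

Definition left_of : rel P := fun x y => y \in left_set x (partner x).

Lemma left_ofxx x : left_of x x = false.
Proof. by rewrite /left_of inE orientxx ltxx. Qed.

Lemma left_of_partner x : left_of x (partner x) = false.
Proof. by rewrite /left_of inE orientxy ltxx. Qed.

Lemma orient_partner_neq0 x y : y != x -> y != partner x ->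
  orient (val x) (val (partner x)) (val y) != 0.
Proof.
move=> yx ym; rewrite orient_eq0 //; last by rewrite eq_sym partner_neq.
by rewrite !inE negb_or yx.
Qed.

Lemma left_of_opp x y : y != x -> y != partner x ->
  left_of (partner x) y = ~~ left_of x y.
Proof.
move=> yx ym; rewrite /left_of partnerK !inE orientC oppr_gt0 -leNgt.
by rewrite le_eqVlt (negPf (orient_partner_neq0 yx ym)).
Qed.

(** By crossing, the two values of orientation along [xx'] have opposite signs, and so do those
    along [yy']; [orient4] equates their differences and so ties the side of [y] to that of [x]. *)
Lemma left_of_swap x y : y != x -> y != partner x ->
  left_of y x = ~~ left_of x y.
Proof.
move=> yx ym; rewrite /left_of !inE.
have xy : x != y by rewrite eq_sym.
have xm : x != partner y by rewrite -(can2_eq partnerK partnerK) eq_sym.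
have yP : y \notin [set x; partner x] by rewrite !inE negb_or yx.
have xP : x \notin [set y; partner y] by rewrite !inE negb_or xy.
have cross := halving_pairs_cross card_P gen halves_unique.
have e1 := cross _ _ _ _ (partnerP x) (partnerP y) yP.
have e2 := cross _ _ _ _ (partnerP y) (partnerP x) xP.
have n1 := orient_partner_neq0 yx ym; have n2 := orient_partner_neq0 xy xm.
have := orient4 (val x) (val (partner x)) (val y) (val (partner y)).
move: n1 n2 e1 e2; do 4!move: (orient _ _ _) => ?; lra.
Qed.

Lemma card_left_of x : #|[set y | left_of x y]| = n.-1.
Proof.
case/andP: (partnerP x) => _ /eqP <-; apply: eq_card => y.
by rewrite inE.
Qed.

(** Evaluating [orient a d] at [w] along both segments gives [t * orient a d b = 0], and [b] is off
    the line [ad]. *)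
Lemma segments_from_common_end (a b d : P) (w : 'rV[R]_2) :
  b != a -> d != a -> b != d ->
  segment (val a) (val b) w -> segment (val a) (val d) w -> w = val a.
Proof.
move=> ba da bd [t [_ zt]] [s [_ zs]].
have /eqP : t * orient (val a) (val d) (val b) = 0.
  transitivity (orient (val a) (val d) w).
    by rewrite zt /orient !mxE; ring.
  by rewrite zs /orient !mxE; ring.
rewrite mulf_eq0 => /orP[/eqP t0|]; first by
  rewrite zt t0 subr0 scale1r scale0r addr0.
by rewrite orient_eq0 1?eq_sym // !inE (negPf ba) (negPf bd).
Qed.

Lemma segmentC (p q z : 'rV[R]_2) : segment p q z -> segment q p z.
Proof.
by move=> [t [t01 ->]]; exists (1 - t); split; [lra|rewrite addrC subKr].
Qed.

(** Edges with a common end meet only there; leaf edges at different centres lie, apart from these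
    centres, strictly on opposite sides of the central line. *)
Lemma plane_double_star x : plane (double_star partner left_of x).
Proof.
have shared (a b d : P) (z : 'rV[R]_2) :
    [set a; b] != [set a; d] -> a != b -> a != d ->
    segment (val a) (val b) z -> segment (val a) (val d) z ->
    exists2 v : P, v \in [set a; b] :&: [set a; d] & z = val v.
  move=> bd ab ad zb zd; exists a; first by rewrite !inE eqxx.
  apply: segments_from_common_end zb zd; rewrite 1?eq_sym //.
  by apply: contraNneq bd => ->.
have arcN := arc_neq partner_neq left_ofxx.
have main (a b c d : P) (z : 'rV[R]_2) :
    a \in [set x; partner x] -> c \in [set x; partner x] ->
    arc partner left_of a b -> arc partner left_of c d ->
    [set a; b] != [set c; d] -> segment (val a) (val b) z ->
    segment (val c) (val d) z ->
    exists2 v : P, v \in [set a; b] :&: [set c; d] & z = val v.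
  move=> ax cx ab cd ne zab zcd.
  have [ac|ac] := eqVneq c a.
    subst c; exact: shared ne (arcN _ _ ab) (arcN _ _ cd) zab zcd.
  have cE : c = partner a.
    move: ax cx ac; rewrite !inE => /orP[]/eqP-> /orP[]/eqP->; rewrite ?eqxx //.
    by rewrite partnerK.
  (* If one of the edges is the central one, it also issues from the other centre, and the
     common-end case applies. *)
  have [bc|bc] := eqVneq b c.
    subst b; move: ne zab; rewrite finset.setUC => ne /segmentC zab.
    exact: shared ne ac (arcN _ _ cd) zab zcd.
  have [da|da] := eqVneq d a.
    subst d; move: ne zcd; rewrite (finset.setUC [set c]) => ne /segmentC zcd.
    by rewrite eq_sym in ac; exact: shared ne (arcN _ _ ab) ac zab zcd.
  move: ab cd; rewrite /arc -cE (negPf bc) cE partnerK (negPf da) /= /left_of !inE.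
  rewrite partnerK (orientC (val a)) oppr_gt0 => hb hd; exfalso.
  move: zab zcd ac => [t [t01 zt]] [s [s01 zs]]; rewrite cE in zs *.
  have e1 : orient (val a) (val (partner a)) z =
      t * orient (val a) (val (partner a)) (val b).
    by rewrite zt /orient !mxE; ring.
  have e2 : orient (val a) (val (partner a)) z =
      s * orient (val a) (val (partner a)) (val d).
    by rewrite zs /orient !mxE; ring.
  (* The value at [z] is nonnegative by [e1] and nonpositive by [e2], so [z] would be both centres
     at once. *)
  have t0 : t = 0 by nra.
  have s0 : s = 0.
    move/eqP: e2; rewrite e1 t0 mul0r eq_sym mulf_eq0 (lt_eqF hd) orbF.
    by move/eqP.
  move: zs; rewrite zt t0 s0 !subr0 !scale1r !scale0r !addr0 => /val_inj <-.
  by rewrite eqxx.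
move=> a b c d /double_starP[u [v [euv ux uv]]] /double_starP[w [t [ewt wx wt]]].
rewrite euv ewt => ne z zab zcd; apply: main => //.
  by case/set2_inj: euv => -[<- <-] //; apply: segmentC.
by case/set2_inj: ewt => -[<- <-] //; apply: segmentC.
Qed.

End HalvingLines.

(** * The partition into [n] trees *)

Theorem theorem3 (R : realType) (n : nat) (P : {fset 'rV[R]_2}) (r : nat)
    (hn : (2 <= n)%N)
    (hP : #|` P| = (2 * n)%N)
    (hgp : general_position P)
    (hr : (1 <= r <= n - 1)%N)
    (h0 : forall p, p \in P -> (halving_lines_at n P 0 p #= `I_1)%card)
    (hk : forall k : nat, (1 <= k <= r)%N ->
       forall p, p \in P -> (halving_lines_at n P k p #= `I_2)%card) :
  exists F : {set {set {set P}}},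
    [/\ finset.partition F (complete_edges P),
        #|F| = n,
        forall E, E \in F ->
          [/\ spanning_tree E, plane E, caterpillar E & symmetric_tree E]
      & forall E1 E2, E1 \in F -> E2 \in F -> isomorphic E1 E2].
Proof.
pose m := partner hP hgp h0; pose left := left_of hP hgp h0.
have mK : involutive m := partnerK hP hgp h0.
have m_neq x : m x != x := partner_neq hP hgp h0 x.
have leftxx x : left x x = false := left_ofxx hP hgp h0 x.
have leftxm x : left x (m x) = false := left_of_partner hP hgp h0 x.
have left_opp x y := @left_of_opp R P n hP hgp h0 x y.
have left_swap x y := @left_of_swap R P n hP hgp h0 x y.
have card_left := card_left_of hP hgp h0.
(* Each centre thus has a leaf of its own, as the caterpillar property requires of the double
   stars. *)
have n1 : (0 < n.-1)%N by lia.
exists (double_stars m left); split.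
- exact: double_stars_partition.
- apply: double_inj; rewrite -(card_double_stars left mK m_neq).
  by rewrite -cardfE hP mul2n.
- move=> _ /imsetP[x _ ->]; split.
  + exact: double_star_spanning.
  + exact: plane_double_star.
  + exact: double_star_caterpillar.
  + exact: double_star_symmetric.
- move=> _ _ /imsetP[x _ ->] /imsetP[y _ ->].
  exact: double_star_isomorphic.
Qed.
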